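(* Let $(M^{4n},\mathcal Q)$ be a $4n$-dimensional manifold equipped with a local $Q^n$-action, with orbit space $B_M$ and transition automorphisms $\{\rho_{\alpha\beta}\}$. The local $Q^n$-action $\mathcal Q$ on $M^{4n}$ is induced by some locally regular $Q^n$-action if and only if $\{\rho_{\alpha\beta}\}$ is cohomologous to the trivial Čech 1-cocycle in $H^1(B_M;\mathrm{Aut}(Q^n))$, where the trivial Čech 1-cocycle is the one whose values on all open sets are equal to the identity map of $Q^n$.
   Context: $Q=\mathrm{Sp}(1)\cong S^3$ is the group of unit quaternions; $Q^n$ acts on $\mathbb H^n$ by coordinatewise left multiplication (the regular representation). For $\rho\in\mathrm{Aut}(Q^n)$ a map $f$ is $\rho$-equivariant if $f(q\cdot x)=\rho(q)\cdot f(x)$. **Locally regular action.** Let $M^{4n}$ be a smooth $4n$-manifold with a smooth $Q^n$-action. A regular coordinate neighborhood is a triple $(U,\rho,\varphi)$ with $U\subset M$ open and $Q^n$-invariant, $\rho\in\mathrm{Aut}(Q^n)$, and $\varphi$ a $\rho$-equivariant diffeomorphism from $U$ onto a $Q^n$-invariant open subset of $\mathbb H^n$. The action is locally regular if every point lies in a regular coordinate neighborhood; an atlas of such is a regular atlas. **Local action.** A weakly regular ($C^r$, $0\le r\le\infty$) atlas on a compact Hausdorff space $M$ is an atlas $\{(U_\alpha^M,\varphi_\alpha^M)\}$ such that each $\varphi_\alpha^M$ is a homeomorphism onto a $Q^n$-invariant open subset of $\mathbb H^n$, and for each nonempty overlap $U^M_{\alpha\beta}=U_\alpha^M\cap U_\beta^M$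 the sets $\varphi_\alpha^M(U^M_{\alpha\beta})$, $\varphi_\beta^M(U^M_{\alpha\beta})$ are $Q^n$-invariant and there is $\rho_{\alpha\beta}\in\mathrm{Aut}(Q^n)$ such that $\varphi_\alpha^M\circ(\varphi_\beta^M)^{-1}$ is a $\rho_{\alpha\beta}$-equivariant $C^r$ diffeomorphism. Two such atlases are equivalent if on each nonempty overlap the change of charts is a $\rho$-equivariant diffeomorphism for some $\rho\in\mathrm{Aut}(Q^n)$. A local $Q^n$-action $\mathcal Q$ on $M$ is an equivalence class of weakly regular atlases. A regular atlas of a locally regular action is weakly regular; $\mathcal Q$ is induced by the locally regular action if it is the class containing its regular atlases. **Orbit space and cocycle.** $B_M$ is the quotient of $\bigsqcup_\alpha\varphi_\alpha^M(U_\alpha^M)/Q^n$ by the identifications induced by the overlap maps of the maximal atlas in $\mathcal Q$, covered by the open sets $U_\alpha^B=\varphi_\alpha^M(U_\alpha^M)/Q^n$. The automorphisms $\rho_{\alpha\beta}$ form a Čech 1-cocycle on $\{U_\alpha^B\}$ with values in the (discrete, generally nonabelian) group $\mathrm{Aut}(Q^n)$, defining a class in $H^1(B_M;\mathrm{Aut}(Q^n))$; being cohomologous to the trivial cocycle means $\rho_{\alpha\beta}=\rho_\alpha\circ\rho_\beta^{-1}$ for some Čech 0-cochain $\{\rho_\alpha\}$.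
   Formalization: For a local action of class C^r the locally regular action is taken of the same class C^r (smooth if r is infinite); equivalence of atlases is the equivalence relation generated by the stated one; Čech cochains are locally constant functions. *)

(* Defs.v *)
From HB Require Import structures.
From mathcomp Require Import all_boot all_order all_algebra ring.
From mathcomp Require Import all_classical all_reals all_analysis.
From Stdlib Require Import Relation_Operators.

Set Implicit Arguments.
Unset Strict Implicit.
Unset Printing Implicit Defensive.

Import Order.TTheory GRing.Theory Num.Theory numFieldNormedType.Exports.

Local Open Scope classical_set_scope.
Local Open Scope ring_scope.
Local Open Scope quotient_scope.

Variant smoothness := Cfin of nat | Cinf.

(* f is C^k on the open set A: k times Frechet differentiable there, with
   continuous derivatives.  As V is finite dimensional in all uses below, the
   derivative x |-> Df(x) is C^k iff x |-> Df(x)(v) is C^k for every v. *)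
Section Ck_def.
Context {R : realType} {V W : normedModType R}.

Fixpoint Ck (k : nat) (A : set V) (f : V -> W) : Prop :=
  if k is k'.+1 then
    (forall x, A x -> differentiable f x) /\ (forall v, Ck k' A ('D_v f))
  else forall x, A x -> {for x, continuous f}.

Definition Cr (r : smoothness) (A : set V) (f : V -> W) : Prop :=
  match r with Cfin k => Ck k A f | Cinf => forall k, Ck k A f end.

End Ck_def.

(* The chain rule for C^k maps, needed for the group structure on Aut(Q^n). *)
Section Ck_theory.
Variable R : realType.

Lemma near_eq_differentiable (V W : normedModType R) (f g : V -> W) x :
  (\near x, f x = g x) -> differentiable f x -> differentiable g x.
Proof.
move=> fg df.
have fgx : f x = g x by exact: (nbhs_singleton fg).
have gE : g \o shift x = cst (g x) + 'd f x +o_ 0 id.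
  have /eqaddoP df' := diff_locally df.
  apply/eqaddoP => e e0; near=> h.
  suff -> : (g \o shift x - (cst (g x) + 'd f x)) h =
            (f \o shift x - (cst (f x) + 'd f x)) h by near: h; exact: df'.
  rewrite !fctE /= fgx; congr (_ - _); apply/esym.
  near: h.
  have : (fun h => h + x) @ (0 : V) --> x.
    by rewrite -[X in _ --> X]add0r; apply: cvgD; [exact: cvg_id|exact: cvg_cst].
  by move=> /(_ _ fg).
apply/diff_locallyP.
by rewrite (diff_unique (diff_continuous df) gE); split; [exact: diff_continuous|].
Unshelve. all: by end_near. Qed.

Lemma Ck_eq (V W : normedModType R) k (A : set V) (f g : V -> W) :
  open A -> {in A, f =1 g} -> Ck k A f -> Ck k A g.
Proof.
move=> oA; elim: k f g => [|k IH] f g fg /=.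
  move=> fc x Ax.
  have fgn : \near x, f x = g x.
    by near=> y; apply: fg; rewrite inE; near: y; exact: open_nbhs_nbhs.
  rewrite /prop_for /continuous_at -(nbhs_singleton fgn).
  by apply: cvg_trans (fc x Ax); exact: near_eq_cvg.
move=> [df dDf]; split=> [x Ax|v].
  apply: near_eq_differentiable (df x Ax).
  by near=> y; apply: fg; rewrite inE; near: y; exact: open_nbhs_nbhs.
apply: IH (dDf v) => x /set_mem Ax; apply: near_eq_derive.
by near=> y; apply: fg; rewrite inE; near: y; exact: open_nbhs_nbhs.
Unshelve. all: by end_near. Qed.

Lemma Ck_pred (V W : normedModType R) k (A : set V) (f : V -> W) :
  Ck k.+1 A f -> Ck k A f.
Proof.
elim: k f => [|k IH] f [df Df] /=.
  by move=> x Ax; apply: differentiable_continuous; exact: df.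
by split=> // v; exact: IH.
Qed.

Lemma Ck_continuous (V W : normedModType R) k (A : set V) (f : V -> W) :
  Ck k A f -> forall x, A x -> {for x, continuous f}.
Proof. by elim: k => // k IH /Ck_pred. Qed.

Lemma Ck_sub (V W : normedModType R) k (A B : set V) (f : V -> W) :
  A `<=` B -> Ck k B f -> Ck k A f.
Proof.
move=> AB; elim: k f => [|k IH] f /=; first by move=> h x /AB/h.
by move=> [df Df]; split=> [x /AB/df//|v]; exact: IH.
Qed.

Lemma Ck_cst (V W : normedModType R) k (A : set V) (a : W) : Ck k A (cst a).
Proof.
elim: k a => [|k IH] a /=; first by move=> x _; exact: cst_continuous.
split=> [x _|v]; first exact: differentiable_cst.
rewrite (_ : 'D_v (cst a) = cst 0) //.
by apply/funext => x; rewrite derive_cst.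
Qed.

Lemma CkD (V W : normedModType R) k (A : set V) (f g : V -> W) : open A ->
  Ck k A f -> Ck k A g -> Ck k A (f + g).
Proof.
move=> oA; elim: k f g => [|k IH] f g /=.
  by move=> fc gc x Ax; apply: continuousD; [exact: fc|exact: gc].
move=> [df Df] [dg Dg]; split=> [x Ax|v].
  by apply: differentiableD; [exact: df|exact: dg].
apply: Ck_eq (IH _ _ (Df v) (Dg v)) => // x /set_mem Ax.
by rewrite deriveD//; apply: diff_derivable; [exact: df|exact: dg].
Qed.

Lemma Ck_sum (V W : normedModType R) k (A : set V) (I : Type) (s : seq I)
    (f : I -> V -> W) : open A ->
  (forall i, Ck k A (f i)) -> Ck k A (\sum_(i <- s) f i).
Proof.
move=> oA Cf; elim: s => [|i s IH]; first by rewrite big_nil; exact: Ck_cst.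
by rewrite big_cons; exact: CkD.
Qed.


Lemma scale_is_bilinear (W : normedModType R) :
  bilinear_for
    (GRing.Scale.Law.clone R W *:%R _) (GRing.Scale.Law.clone R W *:%R _)
    (@GRing.scale R W : R^o -> W -> W).
Proof.
split=> [u'|u] a x y /=.
- by rewrite scalerDl scalerA.
- by rewrite scalerDr !scalerA mulrC.
Qed.
HB.instance Definition _ (W : normedModType R) :=
  bilinear_isBilinear.Build R R^o W W _ _ (@GRing.scale R W : R^o -> W -> W)
  (scale_is_bilinear W).

Lemma diff_scale (V W : normedModType R) (h : V -> R) (f : V -> W) x :
  differentiable h x -> differentiable f x ->
  is_diff x (fun y => h y *: f y) (fun v => h x *: 'd f x v + 'd h x v *: f x).
Proof.
move=> dh df.
have cs : continuous (fun p : R^o * W => p.1 *: p.2).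
  by move=> p; exact: scale_continuous.
pose S : R^o * W -> W := fun p => p.1 *: p.2.
have dS p : is_diff p S (fun q => p.1 *: q.2 + q.1 *: p.2).
  apply: DiffDef; first exact: (differentiable_bilin p cs).
  exact: (diff_bilin p cs).
pose P : V -> R^o * W := fun y => (h y, f y).
have dP : is_diff x P (fun v => ('d h x v, 'd f x v)).
  by apply: is_diff_pair; exact: differentiableP.
by have := is_diff_comp dP (dS (P x)).
Qed.

Lemma CkZ (V W : normedModType R) k (A : set V) (h : V -> R) (f : V -> W) :
  open A -> Ck k A h -> Ck k A f -> Ck k A (fun x => h x *: f x).
Proof.
move=> oA; elim: k h f => [|k IH] h f Ch Cf.
  by move=> x Ax; apply: continuousZ; [exact: Ch|exact: Cf].
have [dh Dh] := Ch; have [df Df] := Cf.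
split=> [x Ax|v].
  by have [] := diff_scale (dh x Ax) (df x Ax).
have := CkD oA (IH _ _ (Ck_pred Ch) (Df v)) (IH _ _ (Dh v) (Ck_pred Cf)).
apply: Ck_eq => // x /set_mem Ax.
have [d dE] := diff_scale (dh x Ax) (df x Ax).
rewrite (deriveE _ d) dE fctE /=.
by rewrite (deriveE _ (df x Ax)) (deriveE _ (dh x Ax)).
Qed.

Lemma Ck_coord (V : normedModType R) m p k (A : set V) (f : V -> 'M[R]_(m, p))
    i j : open A -> Ck k A f -> Ck k A (fun x => f x i j).
Proof.
move=> oA; elim: k f => [|k IH] f.
  move=> Cf x Ax.
  exact: (@continuous_comp _ _ _ f (fun N : 'M[R]_(m, p) => N i j) x (Cf x Ax)
    (@coord_continuous _ _ _ i j (f x))).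
move=> [df Df]; pose c (N : 'M[R]_(m, p)) := N i j : R.
have lc : linear (c : 'M[R]_(m, p) -> R^o) by move=> a u v; rewrite /c !mxE.
pose cL : {linear 'M[R]_(m, p) -> R^o} :=
  HB.pack (c : 'M[R]_(m, p) -> R^o) (GRing.isLinear.Build _ _ _ _ _ lc).
have dc N : is_diff N cL cL.
  have ccL : continuous cL by exact: coord_continuous.
  by apply: DiffDef; [exact: linear_differentiable|exact: diff_lin].
have dcf x : A x -> is_diff x (cL \o f) (cL \o 'd f x).
  by move=> Ax; apply: is_diff_comp => //; apply: differentiableP; exact: df.
split=> [x /dcf[]//|v].
apply: Ck_eq (IH _ (Df v)) => // x /set_mem Ax.
have [d dE] := dcf x Ax; rewrite [RHS](deriveE _ d) dE /=.
by rewrite (deriveE _ (df x Ax)).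
Qed.

Lemma Ck_comp (V W : normedModType R) m p k (A : set V) (B : set 'M[R]_(m, p))
    (f : V -> 'M[R]_(m, p)) (g : 'M[R]_(m, p) -> W) :
  open A -> (forall x, A x -> B (f x)) -> Ck k A f -> Ck k B g ->
  Ck k A (g \o f).
Proof.
move=> oA AB; elim: k f g AB => [|k IH] f g AB Cf Cg.
  move=> x Ax; exact: (@continuous_comp _ _ _ f g x (Cf x Ax) (Cg _ (AB x Ax))).
have [df Df] := Cf; have [dg Dg] := Cg.
split=> [x Ax|v].
  by apply: differentiable_comp; [exact: df|exact: dg _ (AB x Ax)].
have : Ck k A (\sum_(ij : 'I_m * 'I_p)
    (fun x => ('D_v f x) ij.1 ij.2 *: 'D_(delta_mx ij.1 ij.2) g (f x))).
  apply: Ck_sum => // -[i j] /=; apply: CkZ; [exact: oA|exact: (Ck_coord i j oA (Df v))|].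
  exact: (IH f ('D_(delta_mx i j) g) AB (Ck_pred Cf) (Dg _)).
apply: Ck_eq => // x /set_mem Ax.
have dfx := df x Ax; have dgx := dg _ (AB x Ax).
have dgf : differentiable (g \o f) x by exact: differentiable_comp.
rewrite [RHS](deriveE _ dgf) (diff_comp dfx dgx) /=.
rewrite [X in 'd g (f x) X]matrix_sum_delta pair_bigA /= linear_sum.
rewrite fct_sumE; apply: eq_bigr => -[i j] _ /=.
by rewrite linearZ /= (deriveE _ dfx) (deriveE _ dgx).
Qed.

End Ck_theory.

Section quaternions.
Variables (R : realType) (n : nat).

(* Row i of x : 'M[R]_(n, 4) holds the coordinates of the i-th quaternion in
   the basis 1, i, j, k.  The norm and topology of H^n = R^{4n} are those of
   the matrix space. *)
Definition Hn : normedModType R := 'M[R]_(n, 4).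

Implicit Types x y : Hn.

Definition hmul x y : Hn := \matrix_(i, c) nth 0
  [:: x i 0 * y i 0 - x i 1 * y i 1 - x i 2 * y i 2 - x i 3 * y i 3;
      x i 0 * y i 1 + x i 1 * y i 0 + x i 2 * y i 3 - x i 3 * y i 2;
      x i 0 * y i 2 - x i 1 * y i 3 + x i 2 * y i 0 + x i 3 * y i 1;
      x i 0 * y i 3 + x i 1 * y i 2 - x i 2 * y i 1 + x i 3 * y i 0] c.

Definition hone : Hn := \matrix_(i, c) (c == 0)%:R.

Definition hconj x : Hn := \matrix_(i, c) (if c == 0 then x i c else - x i c).

Definition unit_quaternions : set Hn :=
  [set x | forall i, \sum_(c < 4) x i c ^+ 2 = 1].

Definition Qn : Type := set_type unit_quaternions.
HB.instance Definition _ := Choice.on Qn.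

Lemma hmulA : associative hmul.
Proof.
move=> x y z; apply/matrixP => i c; rewrite !mxE.
by case: c => [[|[|[|[|//]]]]] ?; rewrite /= ?mxE /=; ring.
Qed.

Lemma hmul1x : left_id hone hmul.
Proof.
move=> x; apply/matrixP => i c; rewrite !mxE.
case: c => [[|[|[|[|//]]]]] lt_c; rewrite /= ?mxE /=;
  rewrite !(mul0r, mul1r, addr0, subr0, add0r); congr (x i _); exact: val_inj.
Qed.

Lemma hmulx1 : right_id hone hmul.
Proof.
move=> x; apply/matrixP => i c; rewrite !mxE.
case: c => [[|[|[|[|//]]]]] lt_c; rewrite /= ?mxE /=;
  rewrite !(mulr0, mulr1, oppr0, addr0, subr0, add0r); congr (x i _);
  exact: val_inj.
Qed.

Lemma hnormE x i :
  \sum_(c < 4) x i c ^+ 2 =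
  x i 0 ^+ 2 + x i 1 ^+ 2 + x i 2 ^+ 2 + x i 3 ^+ 2.
Proof.
rewrite !big_ord_recl big_ord0 addr0 !addrA.
by congr (_ + _ + _ + _); congr (x i _ ^+ 2); exact: val_inj.
Qed.

Lemma hone_unit : unit_quaternions hone.
Proof. by move=> i; rewrite hnormE !mxE /= expr1n !expr0n /= !addr0. Qed.

Lemma hmul_unit x y : unit_quaternions x -> unit_quaternions y ->
  unit_quaternions (hmul x y).
Proof.
move=> ux uy i; have := ux i; have := uy i; rewrite !hnormE !mxE /= => ey ex.
by rewrite -[RHS]mul1r -{1}ex -ey; ring.
Qed.

Lemma hconj_unit x : unit_quaternions x -> unit_quaternions (hconj x).
Proof. by move=> ux i; rewrite hnormE !mxE /= !sqrrN -hnormE. Qed.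

Lemma hmulVx x : unit_quaternions x -> hmul (hconj x) x = hone.
Proof.
move=> ux; apply/matrixP => i c; have := ux i; rewrite hnormE !mxE => <-.
by case: c => [[|[|[|[|//]]]]] ?; rewrite /= ?mxE /=; ring.
Qed.

Lemma hmulxV x : unit_quaternions x -> hmul x (hconj x) = hone.
Proof.
move=> ux; apply/matrixP => i c; have := ux i; rewrite hnormE !mxE => <-.
by case: c => [[|[|[|[|//]]]]] ?; rewrite /= ?mxE /=; ring.
Qed.

Definition Qn_one : Qn := SigSub (mem_set hone_unit).
Definition Qn_mul (p q : Qn) : Qn :=
  SigSub (mem_set (hmul_unit (set_valP p) (set_valP q))).
Definition Qn_inv (q : Qn) : Qn := SigSub (mem_set (hconj_unit (set_valP q))).

Lemma Qn_mulA : associative Qn_mul.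
Proof. by move=> p q r; apply: val_inj; exact: hmulA. Qed.

Lemma Qn_mul1q : left_id Qn_one Qn_mul.
Proof. by move=> q; apply: val_inj; exact: hmul1x. Qed.

Lemma Qn_mulq1 : right_id Qn_one Qn_mul.
Proof. by move=> q; apply: val_inj; exact: hmulx1. Qed.

Lemma Qn_mulVq : left_inverse Qn_one Qn_inv Qn_mul.
Proof. by move=> q; apply: val_inj; exact: hmulVx (set_valP q). Qed.

Lemma Qn_mulqV : right_inverse Qn_one Qn_inv Qn_mul.
Proof. by move=> q; apply: val_inj; exact: hmulxV (set_valP q). Qed.

HB.instance Definition _ := isGroup.Build Qn
  Qn_mulA Qn_mul1q Qn_mulq1 Qn_mulVq Qn_mulqV.

Definition Qn_val (q : Qn) : Hn := set_val q.

Definition regular_rep (q : Qn) (x : Hn) : Hn := hmul (Qn_val q) x.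

(* Q^n is a submanifold of H^n: a map defined on it is smooth when it extends
   locally to a smooth map on an open subset of H^n. *)
Definition Qn_smooth (f : Qn -> Qn) : Prop :=
  forall q, exists (O : set Hn) (F : Hn -> Hn),
    [/\ open O, O (Qn_val q), Cr Cinf O F &
        forall p, O (Qn_val p) -> F (Qn_val p) = Qn_val (f p)].

Lemma Qn_smooth_id : Qn_smooth id.
Proof.
move=> q; exists setT, id; split => //; first exact: openT.
case=> [|k] /=; first by move=> x _; exact: cvg_id.
split=> [x _|v]; first exact: ex_diff.
rewrite (_ : 'D_v id = cst v); first exact: Ck_cst.
by apply/funext => x; rewrite derive_id.
Qed.

Lemma Qn_smooth_comp (f g : Qn -> Qn) :
  Qn_smooth f -> Qn_smooth g -> Qn_smooth (f \o g).
Proof.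
move=> sf sg q; have [D [G [oD Dq CG GE]]] := sg q.
have [P [F [oP Pq CF FE]]] := sf (g q).
have oDP : open (D `&` G @^-1` P).
  rewrite openE => x [Dx Px]; apply: filterI; first exact: open_nbhs_nbhs.
  by apply: (CG 0%N x Dx); exact: open_nbhs_nbhs.
exists (D `&` G @^-1` P), (F \o G); split => //.
- by split => //=; rewrite GE.
- move=> k; apply: (Ck_comp oDP (B := P)) (CF k); first by move=> x [].
  by apply: Ck_sub (CG k) => x [].
- by move=> p [Dp Pp]; rewrite /= GE// FE// -GE.
Qed.

(* Aut(Q^n), in the sense of Lie groups: smooth automorphisms with smooth
   inverse. *)
Record autQn := AutQn {
  aut_fun :> Qn -> Qn;
  aut_inv : Qn -> Qn;
  aut_funK : cancel aut_fun aut_inv;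
  aut_invK : cancel aut_inv aut_fun;
  aut_funM : {morph aut_fun : p q / (p * q)%g};
  aut_fun_smooth : Qn_smooth aut_fun;
  aut_inv_smooth : Qn_smooth aut_inv }.

HB.instance Definition _ := gen_eqMixin autQn.
HB.instance Definition _ := gen_choiceMixin autQn.

Lemma autQn_ext (a b : autQn) : a =1 b -> a = b.
Proof.
case: a b => [f f' fK f'K fM sf sf'] [g g' gK g'K gM sg sg'] /= /funext fg.
case: _ / fg gK g'K gM sg => gK g'K gM sg.
have fg' : f' = g' by apply/funext => q; rewrite -{1}(g'K q) fK.
case: _ / fg' gK g'K sg' => gK g'K sg'.
by congr AutQn; exact: Prop_irrelevance.
Qed.

Definition aut_one : autQn :=
  @AutQn id id (fun=> erefl) (fun=> erefl) (fun _ _ => erefl)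
    Qn_smooth_id Qn_smooth_id.

Lemma aut_compM (a b : autQn) : {morph a \o b : p q / (p * q)%g}.
Proof. by move=> p q; rewrite /= !aut_funM. Qed.

Definition aut_comp (a b : autQn) : autQn :=
  @AutQn (a \o b) (aut_inv b \o aut_inv a)
    (can_comp (@aut_funK a) (@aut_funK b))
    (can_comp (@aut_invK b) (@aut_invK a)) (aut_compM a b)
    (Qn_smooth_comp (@aut_fun_smooth a) (@aut_fun_smooth b))
    (Qn_smooth_comp (@aut_inv_smooth b) (@aut_inv_smooth a)).

Lemma aut_invM (a : autQn) : {morph aut_inv a : p q / (p * q)%g}.
Proof.
by move=> p q; apply: (can_inj (@aut_funK a)); rewrite aut_funM !aut_invK.
Qed.

Definition aut_inverse (a : autQn) : autQn :=
  AutQn (@aut_invK a) (@aut_funK a) (@aut_invM a)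
    (@aut_inv_smooth a) (@aut_fun_smooth a).

Lemma aut_compA : associative aut_comp.
Proof. by move=> a b c; exact: autQn_ext. Qed.

Lemma aut_comp1 : left_id aut_one aut_comp.
Proof. by move=> a; exact: autQn_ext. Qed.

Lemma aut_1comp : right_id aut_one aut_comp.
Proof. by move=> a; exact: autQn_ext. Qed.

Lemma aut_compV : left_inverse aut_one aut_inverse aut_comp.
Proof. by move=> a; apply: autQn_ext => q; exact: aut_funK. Qed.

Lemma aut_Vcomp : right_inverse aut_one aut_inverse aut_comp.
Proof. by move=> a; apply: autQn_ext => q; exact: aut_invK. Qed.

HB.instance Definition _ := isGroup.Build autQn
  aut_compA aut_comp1 aut_1comp aut_compV aut_Vcomp.

End quaternions.

(* Cech cohomology, in degrees 0 and 1, of the constant sheaf with values in a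
   discrete group G.  Cochains are families of sections of this sheaf, i.e. of
   locally constant functions; their values outside the relevant open sets are
   irrelevant. *)
Section cech.
Variables (X : topologicalType) (G : groupType).
Variables (I : Type) (U : I -> set X).

Definition locally_constant (A : set X) (f : X -> G) : Prop :=
  forall x, A x -> \forall y \near x, A y -> f y = f x.

Definition cech_cochain0 (s : I -> X -> G) : Prop :=
  forall i, locally_constant (U i) (s i).

Definition cech_cochain1 (r : I -> I -> X -> G) : Prop :=
  forall i j, locally_constant (U i `&` U j) (r i j).

Definition cech_cocycle1 (r : I -> I -> X -> G) : Prop :=
  cech_cochain1 r /\
  forall i j k x, (U i `&` U j `&` U k) x ->
    (r i j x * r j k x = r i k x)%g.

Definition cech_cohomologous (r r' : I -> I -> X -> G) : Prop :=
  [/\ cech_cocycle1 r, cech_cocycle1 r' &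
   exists2 s, cech_cochain0 s &
     forall i j x, (U i `&` U j) x ->
       (r i j x = s i x * r' i j x * (s j x)^-1)%g].

Definition cech_trivial : I -> I -> X -> G := fun _ _ _ => 1%g.

End cech.

Section charts.
Variables (R : realType) (n : nat) (M : topologicalType).
Local Notation Hn := (Hn R n).
Local Notation Qn := (Qn R n).
Local Notation autQn := (autQn R n).

(* The values of the map outside of its domain are irrelevant. *)
Record chart := Chart { dom : set M; chart_map :> M -> Hn }.

HB.instance Definition _ := gen_eqMixin chart.
HB.instance Definition _ := gen_choiceMixin chart.

Implicit Types (c d : chart) (A B S : set chart) (r : smoothness).

Definition topological_chart c : Prop :=
  [/\ open (dom c), {within dom c, continuous c}, {in dom c &, injective c} &
      forall V, open V -> V `<=` dom c -> open (c @` V)].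

Definition overlap c d : set M := dom c `&` dom d.

Definition covers A : Prop := forall x, exists2 c, A c & dom c x.

Definition Qn_invariant (D : set Hn) : Prop :=
  forall (q : Qn) x, D x -> D (regular_rep q x).

Definition Cr_diffeo r (D E : set Hn) (g : Hn -> Hn) : Prop :=
  exists h : Hn -> Hn,
    [/\ {homo g : x / D x >-> E x}, {homo h : y / E y >-> D y},
        {in D, cancel g h} /\ {in E, cancel h g}, Cr r D g & Cr r E h].

Definition equivariant (rho : autQn) (D : set Hn) (g : Hn -> Hn) : Prop :=
  forall q x, D x -> g (regular_rep q x) = regular_rep (rho q) (g x).

(* g is the change of charts c \o d^-1 : d(U_cd) -> c(U_cd) *)
Definition change_of_charts c d (g : Hn -> Hn) : Prop :=
  forall z, overlap c d z -> g (d z) = c z.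

Definition Cr_compatible r c d : Prop :=
  exists2 g, change_of_charts c d g &
    Cr_diffeo r (d @` overlap c d) (c @` overlap c d) g.

Definition equivariant_change r (rho : autQn) c d : Prop :=
  [/\ Qn_invariant (c @` overlap c d), Qn_invariant (d @` overlap c d) &
   exists g, [/\ change_of_charts c d g,
     Cr_diffeo r (d @` overlap c d) (c @` overlap c d) g &
     equivariant rho (d @` overlap c d) g]].

Definition weakly_regular_atlas r A : Prop :=
  [/\ forall c, A c -> topological_chart c /\ Qn_invariant (c @` dom c),
      covers A &
      forall c d, A c -> A d -> overlap c d !=set0 ->
        exists rho, equivariant_change r rho c d].

Definition equivalent_atlases r A B : Prop :=
  [/\ weakly_regular_atlas r A, weakly_regular_atlas r B &
      forall c d, A c -> B d -> overlap c d !=set0 ->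
        exists rho, equivariant_change r rho c d].

(* The relation [equivalent_atlases] is not transitive: when overlaps are not
   connected, composing through an intermediate atlas may give different
   automorphisms on different components of an overlap.  A local action is
   therefore a class of the equivalence relation it generates. *)
Definition local_action r (Q : set (set chart)) : Prop :=
  exists2 A, weakly_regular_atlas r A &
    Q = [set B | clos_refl_sym_trans _ (equivalent_atlases r) A B].

Definition transition_automorphisms r A (rho : A -> A -> autQn) : Prop :=
  forall a b : A, overlap (val a) (val b) !=set0 ->
    equivariant_change r (rho a b) (val a) (val b).

(* An atlas of a C^r manifold structure of dimension 4n on M, with H^n as model
   space.  As local actions have a regularity class r, "smooth" is read as
   "C^r" for locally regular actions too; r = Cinf is the usual notion. *)
Definition Cr_atlas r S : Prop :=
  [/\ forall c, S c -> topological_chart c, covers S &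
      forall c d, S c -> S d -> Cr_compatible r c d].

Definition is_action (act : Qn -> M -> M) : Prop :=
  (forall x, act 1%g x = x) /\
  (forall p q x, act (p * q)%g x = act p (act q x)).

(* The map (q, x) |-> act q x is C^r on Q^n x M: read in charts of M, it
   extends locally to a C^r map on an open subset of H^n x H^n. *)
Definition Cr_action r S (act : Qn -> M -> M) : Prop :=
  forall q x, exists c d (O : set (Hn * Hn)) (F : Hn * Hn -> Hn),
    [/\ S c /\ S d, dom c x, open O /\ O (Qn_val q, c x), Cr r O F &
        forall p y, dom c y -> O (Qn_val p, c y) ->
          dom d (act p y) /\ F (Qn_val p, c y) = d (act p y)].

(* The triple (dom c, rho, c): by the fourth clause, c is a C^r diffeomorphism
   onto its image for the structure given by S. *)
Definition regular_neighborhood r S (act : Qn -> M -> M) c (rho : autQn) :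
    Prop :=
  [/\ topological_chart c,
      forall q x, dom c x -> dom c (act q x),
      Qn_invariant (c @` dom c),
      forall d, S d -> Cr_compatible r c d &
      forall q x, dom c x -> c (act q x) = regular_rep (rho q) (c x)].

Definition locally_regular_action r S (act : Qn -> M -> M) : Prop :=
  [/\ Cr_atlas r S, is_action act, Cr_action r S act &
      forall x, exists c rho, regular_neighborhood r S act c rho /\ dom c x].

Definition regular_atlas r S (act : Qn -> M -> M) (T : set (chart * autQn)) :
    Prop :=
  (forall c rho, T (c, rho) -> regular_neighborhood r S act c rho) /\
  covers (fst @` T).

Definition induced_by r S (act : Qn -> M -> M) (Q : set (set chart)) : Prop :=
  forall T, regular_atlas r S act T -> Q (fst @` T).

Definition maximal_atlas (Q : set (set chart)) : set chart :=
  [set c | exists2 A, Q A & A c].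

Section orbit_space.
Variable F : set chart.

Definition chart_union : topologicalType :=
  {c : F & set_type (val c @` dom (val c))}.

Variant identified : chart_union -> chart_union -> Prop :=
| Same_orbit (c : F) (x y : set_type (val c @` dom (val c))) (q : Qn) :
    val y = regular_rep q (val x) ->
    identified (existT _ c x) (existT _ c y)
| Same_point (c d : F) (x : set_type (val c @` dom (val c)))
    (y : set_type (val d @` dom (val d))) (z : M) :
    overlap (val c) (val d) z -> val x = val c z -> val y = val d z ->
    identified (existT _ c x) (existT _ d y).

Definition orbit_rel (x y : chart_union) : bool :=
  `[< clos_refl_sym_trans _ identified x y >].

Lemma orbit_rel_refl : reflexive orbit_rel.
Proof. by move=> x; apply/asboolP; exact: rst_refl. Qed.

Lemma orbit_rel_sym : symmetric orbit_rel.
Proof. by move=> x y; apply/asboolP/asboolP; exact: rst_sym. Qed.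

Lemma orbit_rel_trans : transitive orbit_rel.
Proof.
by move=> y x z /asboolP xy /asboolP yz; apply/asboolP; exact: rst_trans yz.
Qed.

Definition orbit_equiv :=
  EquivRel _ orbit_rel_refl orbit_rel_sym orbit_rel_trans.

End orbit_space.

(* B_M; the passage to the orbits of Q^n and the gluing along the overlaps are
   performed in a single quotient. *)
Definition orbit_space (Q : set (set chart)) : topologicalType :=
  quotient_topology {eq_quot orbit_equiv (maximal_atlas Q)}.

(* the open subset U_c^B = c(U_c) / Q^n of B_M *)
Definition orbit_chart (Q : set (set chart)) c : set (orbit_space Q) :=
  [set b | exists2 e : chart_union (maximal_atlas Q),
    val (projT1 e) = c & b = \pi_(orbit_space Q) e].

End charts.

Arguments orbit_chart {R n M} Q c _.

(* Main.v *)
(* For the direct implication, an invariant neighbourhood of an orbit in a chart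
   a of A carries the regular action twisted by a single automorphism
   s_a, unique because Q^n acts freely on part of every nonempty open set.
   Changing charts multiplies s_a by rho_ab, so rho_ab = s_a s_b^-1.
   Conversely, if rho_ab = s_a s_b^-1, the formulas
   a (q . z) = s_a(z)(q) a(z) agree on overlaps and define an action; the charts
   a restricted to the open invariant sets where s_a is constant are
   regular for it, and they form an atlas equivalent both to A and to any
   other regular atlas of this action. *)
Require Import Defs.
From mathcomp Require Import all_boot all_order all_algebra ring.
From mathcomp Require Import all_classical all_reals all_analysis.
From Stdlib Require Import Relation_Operators.

Set Implicit Arguments.
Unset Strict Implicit.
Unset Printing Implicit Defensive.

Import Order.TTheory GRing.Theory Num.Theory numFieldNormedType.Exports.

Local Open Scope classical_set_scope.
Local Open Scope ring_scope.
Local Open Scope quotient_scope.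

(** * Further calculus of C^r maps, up to quaternionic multiplication *)

Section Ck_extra.
Variable R : realType.

(** Continuity and differentiability in [Ck] are tested at single points in the ambient space, and
    ['D_v f] does not depend on the set, so induction on [k] goes through. *)
Lemma Ck_local (V W : normedModType R) k (A : set V) (f : V -> W) :
  (forall x, A x -> exists B, [/\ open B, B x & Ck k B f]) -> Ck k A f.
Proof.
elim: k f => [|k IH] f loc /=.
  by move=> x /loc[B [_ Bx Cf]]; exact: Cf.
split=> [x Ax|v].
  by have [B [_ Bx [df _]]] := loc x Ax; exact: df.
apply: IH => x Ax.
have [B [oB Bx [_ Df]]] := loc x Ax.
by exists B; split=> //; exact: Df.
Qed.

(** Treats finite and infinite [r] at once, so that facts about [Ck] pass to [Cr]. *)
Lemma CrE (V W : normedModType R) r (A : set V) (f : V -> W) :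
  Cr r A f <-> forall k, (if r is Cfin m then k = m else True) -> Ck k A f.
Proof.
case: r => [m|] /=; first by split=> [Cf _ ->|]; [|apply].
by split=> Cf k; [move=> _; exact: Cf|exact: Cf].
Qed.

Lemma Cr_local (V W : normedModType R) r (A : set V) (f : V -> W) :
  (forall x, A x -> exists B, [/\ open B, B x & Cr r B f]) -> Cr r A f.
Proof.
move=> loc; apply/CrE => k rk; apply: Ck_local => x /loc[B [oB Bx /CrE Cf]].
by exists B; split=> //; exact: Cf.
Qed.

Lemma Cr_eq (V W : normedModType R) r (A : set V) (f g : V -> W) :
  open A -> {in A, f =1 g} -> Cr r A f -> Cr r A g.
Proof.
move=> oA fg /CrE Cf; apply/CrE => k rk.
by apply: Ck_eq oA fg _; exact: Cf.
Qed.

Lemma Cr_sub (V W : normedModType R) r (A B : set V) (f : V -> W) :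
  A `<=` B -> Cr r B f -> Cr r A f.
Proof.
move=> AB /CrE Cf; apply/CrE => k rk.
by apply: Ck_sub AB _; exact: Cf.
Qed.

Lemma Cr_comp (V W : normedModType R) m p r (A : set V) (B : set 'M[R]_(m, p))
    (f : V -> 'M[R]_(m, p)) (g : 'M[R]_(m, p) -> W) :
  open A -> (forall x, A x -> B (f x)) -> Cr r A f -> Cr r B g ->
  Cr r A (g \o f).
Proof.
move=> oA AB /CrE Cf /CrE Cg; apply/CrE => k rk.
by apply: (Ck_comp oA AB); [exact: Cf|exact: Cg].
Qed.

Lemma Ck_linear (V W : normedModType R) k (A : set V) (f : {linear V -> W}) :
  continuous f -> Ck k A f.
Proof.
case: k => [|k] cf; first by move=> x _; exact: cf.
split=> [x _|v]; first exact: linear_differentiable.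
rewrite (_ : 'D_v f = cst (f v)); first exact: Ck_cst.
apply/funext => x; rewrite deriveE; last exact: linear_differentiable.
by rewrite diff_lin.
Qed.

(** [f] is the finite sum of its coordinates times the constant matrices [delta_mx]. *)
Lemma Ck_mx (V : normedModType R) m p k (A : set V) (f : V -> 'M[R]_(m, p)) :
  open A -> (forall i j, Ck k A (fun x => f x i j)) -> Ck k A f.
Proof.
move=> oA Cf.
have : Ck k A (\sum_(ij : 'I_m * 'I_p)
    (fun x => f x ij.1 ij.2 *: delta_mx ij.1 ij.2)).
  apply: Ck_sum => // ij; apply: CkZ => //; exact: Ck_cst.
apply: Ck_eq => // x _; rewrite fct_sumE [RHS]matrix_sum_delta pair_bigA /=.
by apply: eq_bigr.
Qed.

Lemma CkM (V : normedModType R) k (A : set V) (f g : V -> R) : open A ->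
  Ck k A f -> Ck k A g -> Ck k A (fun x => f x * g x).
Proof. by move=> oA Cf Cg; apply: (CkZ oA Cf (f := g : V -> R^o)). Qed.

Lemma CkB (V : normedModType R) k (A : set V) (f g : V -> R) : open A ->
  Ck k A f -> Ck k A g -> Ck k A (fun x => f x - g x).
Proof.
move=> oA Cf Cg.
have : Ck k A ((f : V -> R^o) + (fun x => - 1 * g x : R^o)).
  by apply: CkD => //; apply: CkM => //; exact: Ck_cst.
by apply: Ck_eq => // x _; rewrite fctE mulN1r.
Qed.

(** Each coordinate of the product is a quadratic polynomial in the coordinates of the factors. The
    regularity of the constructed action reduces to this. *)
Lemma Ck_hmul (V : normedModType R) n k (A : set V) (f g : V -> Hn R n) :
  open A -> Ck k A f -> Ck k A g -> Ck k A (fun x => hmul (f x) (g x)).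
Proof.
move=> oA Cf Cg; apply: Ck_mx => // i c.
have P a b : Ck k A (fun x => f x i a * g x i b).
  by apply: CkM => //; exact: Ck_coord.
have D (u v : V -> R) : Ck k A u -> Ck k A v -> Ck k A (fun x => u x + v x).
  by move=> Cu Cv; apply: (@CkD _ _ R^o k A u v).
have : Ck k A (fun x => nth 0
  [:: f x i 0 * g x i 0 - f x i 1 * g x i 1
        - f x i 2 * g x i 2 - f x i 3 * g x i 3;
      f x i 0 * g x i 1 + f x i 1 * g x i 0
        + f x i 2 * g x i 3 - f x i 3 * g x i 2;
      f x i 0 * g x i 2 - f x i 1 * g x i 3
        + f x i 2 * g x i 0 + f x i 3 * g x i 1;
      f x i 0 * g x i 3 + f x i 1 * g x i 2
        - f x i 2 * g x i 1 + f x i 3 * g x i 0] c).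
  by case: c => [[|[|[|[|//]]]]] lt_c /=;
    repeat first [exact: P | apply: (CkB oA) | apply: (D _ _)].
by apply: Ck_eq => // x _; rewrite mxE.
Qed.

End Ck_extra.

(** * The regular representation: linearity and faithfulness on open sets *)

Section regular_representation.
Variables (R : realType) (n : nat).
Implicit Types (p q : Qn R n) (x y : Hn R n).

Lemma regular_rep1 x : regular_rep 1%g x = x.
Proof. exact: hmul1x. Qed.

Lemma regular_repM p q x :
  regular_rep p (regular_rep q x) = regular_rep (p * q)%g x.
Proof. exact: hmulA. Qed.

Lemma regular_repD p x y :
  regular_rep p (x + y) = regular_rep p x + regular_rep p y.
Proof.
by apply/matrixP => -i [[|[|[|[|//]]]] ?]; rewrite !mxE /= ?mxE /=; ring.
Qed.

Lemma regular_repZ p (t : R) x :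
  regular_rep p (t *: x) = t *: regular_rep p x.
Proof.
by apply/matrixP => -i [[|[|[|[|//]]]] ?]; rewrite !mxE /= ?mxE /=; ring.
Qed.

(* Evaluate at [x] and at [x + t 1], with [t] a small nonzero real. *)
Lemma regular_rep_faithful (D : set (Hn R n)) p q : open D -> D !=set0 ->
  (forall x, D x -> regular_rep p x = regular_rep q x) -> p = q.
Proof.
move=> oD [x Dx] pq.
have cvx : (fun t : R => x + t *: hone R n) @ 0^' --> x.
  apply: cvg_trans (_ : (fun t : R => x + t *: hone R n) @ (0 : R) --> x).
    by apply: cvg_app; exact: cvg_within.
  rewrite -[X in _ --> X]addr0 -(scale0r (hone R n)).
  by apply: cvgD; [exact: cvg_cst|apply: cvgZr_tmp; exact: cvg_id].
have /filter_ex[t [/= t0 Dt]] :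
    \forall t \near (0 : R)^', t != 0 /\ D (x + t *: hone R n).
  near=> t; split; first by near: t; exact: nbhs_dnbhs_neq.
  by near: t; apply: cvx; exact: open_nbhs_nbhs.
have := pq _ Dt; rewrite !regular_repD (pq _ Dx) => /addrI.
rewrite !regular_repZ => /(scalerI t0).
by rewrite /regular_rep !hmulx1 => ?; exact: val_inj.
Unshelve. all: by end_near. Qed.

End regular_representation.

(** * Changes of charts and regular neighborhoods *)

Section chart_theory.
Variables (R : realType) (n : nat) (M : topologicalType).
Local Notation chart := (chart R n M).
Implicit Types (c d a : chart) (r : smoothness) (W : set M) (S : set chart).

Lemma overlapC c d : overlap c d = overlap d c.
Proof. exact: setIC. Qed.

Lemma topological_chart_inj c z w : topological_chart c ->
  dom c z -> dom c w -> c z = c w -> z = w.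
Proof. by move=> [_ _ cI _] cz cw; apply: cI; rewrite inE. Qed.

Lemma topological_chart_open c W : topological_chart c -> open W ->
  W `<=` dom c -> open (c @` W).
Proof. by move=> [_ _ _]; apply. Qed.

Lemma topological_chart_cvg c z : topological_chart c -> dom c z ->
  {for z, continuous c}.
Proof.
move=> [oc + _ _] cz; rewrite continuous_open_subspace// => cc.
by apply: cc; rewrite inE.
Qed.

Lemma open_overlap c d :
  topological_chart c -> topological_chart d -> open (overlap c d).
Proof. by move=> [oc _ _ _] [od _ _ _]; exact: openI. Qed.

Definition chart_restr c W : chart := Chart (dom c `&` W) c.

Lemma topological_chart_restr c W :
  topological_chart c -> open W -> topological_chart (chart_restr c W).
Proof.
move=> [oc cc cI co] oW; split => /=.
- exact: openI.
- by apply: continuous_subspaceW cc => z [].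
- by move=> z w /set_mem[cz _] /set_mem[cw _]; apply: cI; rewrite inE.
- by move=> V oV VcW; apply: co => // z /VcW[].
Qed.

Lemma change_of_charts_exists c d : topological_chart d ->
  exists g, change_of_charts c d g.
Proof.
move=> td.
have /choice[g gP] (y : Hn R n) :
    exists w, forall z, overlap c d z -> d z = y -> w = c z.
  have [[z [cdz dzy]]|no] := pselect (exists z, overlap c d z /\ d z = y).
    exists (c z) => w [cw dw] dwy; congr (c _); case: cdz => cz dz.
    by apply: (topological_chart_inj td) => //; rewrite dzy.
  (* Off the image of the overlap the value is arbitrary. *)
  by exists 0 => z cdz dzy; case: no; exists z.
by exists g => z cdz; exact: gP.
Qed.

(** Both maps are determined by the points of the overlap, so they are mutually inverse and only
    their regularity has to be supplied. *)
Lemma Cr_diffeo_change r c d g h :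
  change_of_charts c d g -> change_of_charts d c h ->
  Cr r (d @` overlap c d) g -> Cr r (c @` overlap c d) h ->
  Cr_diffeo r (d @` overlap c d) (c @` overlap c d) g.
Proof.
move=> gE hE Cg Ch.
have hE' z : overlap c d z -> h (c z) = d z by rewrite overlapC => /hE.
exists h; split => //.
- by move=> _ [z cdz <-]; rewrite gE//; exists z.
- by move=> _ [z cdz <-]; rewrite hE'//; exists z.
- by split=> _ /set_mem[z cdz <-]; rewrite ?(gE, hE')// ?(gE, hE').
Qed.

Lemma Cr_compatibleP r c d : Cr_compatible r c d <->
  exists g h, [/\ change_of_charts c d g, change_of_charts d c h,
    Cr r (d @` overlap c d) g & Cr r (c @` overlap c d) h].
Proof.
split=> [[g gE [h [_ _ [gK _] Cg Ch]]]|[g [h [gE hE Cg Ch]]]].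
  exists g, h; split=> // z; rewrite overlapC => cdz.
  by rewrite -gE// gK// inE; exists z.
by exists g => //; exact: Cr_diffeo_change hE _ _.
Qed.

Lemma Cr_compatible_sym r c d : Cr_compatible r c d -> Cr_compatible r d c.
Proof.
move=> /Cr_compatibleP[g [h [? ? ? ?]]]; apply/Cr_compatibleP.
by exists h, g; rewrite overlapC.
Qed.

Lemma Cr_compatible_restr r c d W : Cr_compatible r c d ->
  Cr_compatible r (chart_restr c W) d.
Proof.
move=> /Cr_compatibleP[g [h [gE hE Cg Ch]]]; apply/Cr_compatibleP.
exists g, h; split.
- by move=> z [[cz _] dz]; apply: gE.
- by move=> z [dz [cz _]]; apply: hE.
- by apply: Cr_sub Cg => _ [z [[cz _] dz] <-]; exists z.
- by apply: Cr_sub Ch => _ [z [[cz _] dz] <-]; exists z.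
Qed.

Lemma Cr_compatible_disjoint r c d : topological_chart c ->
  topological_chart d -> ~ (overlap c d !=set0) -> Cr_compatible r c d.
Proof.
move=> tc td cd0.
have [g gE] := change_of_charts_exists c td.
have [h hE] := change_of_charts_exists d tc.
apply/Cr_compatibleP; exists g, h; split=> //;
  by apply: Cr_local => ? [z cdz _]; case: cd0; exists z.
Qed.

(** Near [d z], the map [g] is the composite of the changes from [d] to [a] and from [a] to [c], for
    a chart [a] of [S] around [z]. *)
Lemma Cr_change_via r S c d g : covers S ->
  (forall a, S a -> topological_chart a) ->
  topological_chart c -> topological_chart d ->
  (forall a, S a -> Cr_compatible r c a) ->
  (forall a, S a -> Cr_compatible r d a) ->
  change_of_charts c d g -> Cr r (d @` overlap c d) g.
Proof.
move=> covS tS tc td cS dS gE; apply: Cr_local => _ [z [cz dz] <-].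
have [a Sa az] := covS z.
have /Cr_compatibleP[gc [_ [gcE _ Cgc _]]] := cS a Sa.
have /Cr_compatibleP[_ [hd [_ hdE _ Chd]]] := dS a Sa.
have oB : open (d @` (overlap c d `&` dom a)).
  apply: topological_chart_open => //; last by move=> w [[]].
  by apply: openI; [exact: open_overlap|case: (tS _ Sa)].
exists (d @` (overlap c d `&` dom a)); split=> //; first by exists z.
apply: (@Cr_eq _ _ _ _ _ (gc \o hd)) => //.
  move=> _ /set_mem[w [[cw dw] aw] <-] /=.
  by rewrite hdE// gcE// gE.
apply: Cr_comp Cgc => //.
  by move=> _ [w [[cw dw] aw] <-]; rewrite hdE//; exists w.
by apply: Cr_sub Chd => _ [w [[cw dw] aw] <-]; exists w.
Qed.

Lemma Cr_compatible_via r S c d : covers S ->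
  (forall a, S a -> topological_chart a) ->
  topological_chart c -> topological_chart d ->
  (forall a, S a -> Cr_compatible r c a) ->
  (forall a, S a -> Cr_compatible r d a) -> Cr_compatible r c d.
Proof.
move=> covS tS tc td cS dS.
have [g gE] := change_of_charts_exists c td.
have [h hE] := change_of_charts_exists d tc.
apply/Cr_compatibleP; exists g, h; split=> //.
  exact: (Cr_change_via covS).
by rewrite overlapC; exact: (Cr_change_via covS).
Qed.

(** Left multiplication by [q] in [d] is the action of [t^-1 q] on M, which [c] reads as
    multiplication by [s (t^-1 q)]. The invariance of the two images follows in the same way from
    that of the overlap. *)
Lemma act_equivariant_change r (act : Qn R n -> M -> M) c d
    (s t : autQn R n) :
  Cr_compatible r c d ->
  (forall q z, overlap c d z -> overlap c d (act q z)) ->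
  (forall q z, overlap c d z -> c (act q z) = regular_rep (s q) (c z)) ->
  (forall q z, overlap c d z -> d (act q z) = regular_rep (t q) (d z)) ->
  equivariant_change r (s * t^-1)%g c d.
Proof.
move=> [g gE gdiff] inv cE dE; split.
- move=> q _ [z cdz <-]; exists (act (aut_inv s q) z); first exact: inv.
  by rewrite cE// aut_invK.
- move=> q _ [z cdz <-]; exists (act (aut_inv t q) z); first exact: inv.
  by rewrite dE// aut_invK.
exists g; split=> // q _ [z cdz <-].
have -> : regular_rep q (d z) = d (act (aut_inv t q) z).
  by rewrite dE// aut_invK.
by rewrite gE ?cE ?gE//; exact: inv.
Qed.

Lemma regular_neighborhoods_change r S act c d (s t : autQn R n) :
  Cr_atlas r S -> regular_neighborhood r S act c s ->
  regular_neighborhood r S act d t -> equivariant_change r (s * t^-1)%g c d.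
Proof.
move=> [tS covS _] [tc cinv _ cS cE] [td dinv _ dS dE].
apply: (act_equivariant_change (act := act)).
- exact: (Cr_compatible_via covS).
- by move=> q z [cz dz]; split; [exact: cinv|exact: dinv].
- by move=> q z [cz dz]; exact: cE.
- by move=> q z [cz dz]; exact: dE.
Qed.

Lemma regular_atlas_weakly_regular r S act (T : set (chart * autQn R n)) :
  Cr_atlas r S -> regular_atlas r S act T -> weakly_regular_atlas r (fst @` T).
Proof.
move=> SP [TP covT]; split=> //.
- by move=> _ [[c s] /TP[tc _ ic _ _] <-].
- move=> _ _ [[c s] /TP Tc <-] [[d t] /TP Td <-] _.
  by exists (s * t^-1)%g; exact: (regular_neighborhoods_change SP Tc Td).
Qed.

(** Shows that a locally regular action determines a single local action. *)
Lemma regular_atlases_equivalent r S act (T T' : set (chart * autQn R n)) :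
  Cr_atlas r S -> regular_atlas r S act T -> regular_atlas r S act T' ->
  equivalent_atlases r (fst @` T) (fst @` T').
Proof.
move=> SP TP TP'; split.
- exact: regular_atlas_weakly_regular TP.
- exact: regular_atlas_weakly_regular TP'.
- move=> _ _ [[c s] /TP.1 Tc <-] [[d t] /TP'.1 Td <-] _.
  by exists (s * t^-1)%g; exact: (regular_neighborhoods_change SP Tc Td).
Qed.


End chart_theory.

(** * Equivariance near a point between charts of a local action *)

Section local_equivariance.
Variables (R : realType) (n : nat) (M : topologicalType).
Local Notation chart := (chart R n M).
Implicit Types (c d e : chart) (r : smoothness) (Q : set (set chart)).

(* A local substitute for [equivariant_change] which, unlike it, composes along
   the chains of atlases generating a local action. *)
Definition locally_equivariant c d z : Prop :=
  exists (s : autQn R n) (W : set M), [/\ open W, W z, W `<=` overlap c d &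
    forall q y, W y -> exists y', [/\ W y', c y' = regular_rep q (c y) &
      d y' = regular_rep (s q) (d y)]].

Lemma locally_equivariant_sym c d z :
  locally_equivariant c d z -> locally_equivariant d c z.
Proof.
move=> [s [W [oW Wz Wcd sW]]]; exists (s^-1)%g, W; split=> //.
  by rewrite overlapC.
move=> q y /(sW (aut_inv s q))[y' [Wy' cy' dy']].
by exists y'; split=> //; rewrite dy' aut_invK.
Qed.

Lemma locally_equivariant_trans c d e z : topological_chart d ->
  locally_equivariant c d z -> locally_equivariant d e z ->
  locally_equivariant c e z.
Proof.
move=> td [s [W [oW Wz Wcd sW]]] [t [V [oV Vz Vde tV]]].
exists (t * s)%g, (W `&` V); split; [exact: openI|by []| |].
  by move=> y [/Wcd[? _] /Vde[]].
move=> q y [Wy Vy]; have [y' [Wy' cy' dy']] := sW q y Wy.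
have [y2 [Vy2 dy2 ey2]] := tV (s q) y Vy.
(* The translates found in [W] and in [V] have the same image under [d], hence coincide and lie in
   [W] and [V] at once. *)
have y2E : y' = y2.
  apply: (topological_chart_inj td); last by rewrite dy' dy2.
  - by have [] := Wcd _ Wy'.
  - by have [] := Vde _ Vy2.
by exists y'; split=> //; [split=> //; rewrite y2E|rewrite y2E ey2].
Qed.

Lemma equivariant_change_locally r s c d z :
  topological_chart c -> topological_chart d ->
  equivariant_change r s c d -> overlap c d z -> locally_equivariant c d z.
Proof.
move=> tc td [_ dinv [g [gE _ geq]]] cdz; apply: locally_equivariant_sym.
exists s, (overlap c d); split=> //.
- exact: open_overlap.
- by rewrite overlapC.
move=> q y cdy.
have [y' cdy' y'E] : (d @` overlap c d) (regular_rep q (d y)).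
  by apply: dinv; exists y.
exists y'; split=> //.
by rewrite -gE// y'E geq ?gE//; exists y.
Qed.

Lemma equivalence_weakly_regular r (A B : set chart) :
  clos_refl_sym_trans _ (equivalent_atlases r) A B ->
  weakly_regular_atlas r A <-> weakly_regular_atlas r B.
Proof.
by elim=> {A B} [B C [wB wC _]|//|B C _ <-//|B C D _ -> _ ->//]; split.
Qed.

Lemma equivalence_locally_equivariant r (A B : set chart) c d z :
  clos_refl_sym_trans _ (equivalent_atlases r) A B ->
  weakly_regular_atlas r A -> A c -> B d -> overlap c d z ->
  locally_equivariant c d z.
Proof.
move=> AB; elim: AB c d z => {A B} [A B [wA wB AB]|A|A B AB IH|
  A B C AB IH BC IH'] c d z.
- move=> _ Ac Bd cdz; have [s cds] : exists s, equivariant_change r s c d.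
    by apply: AB => //; exists z.
  have [[tA _ _] [tB _ _]] := (wA, wB).
  apply: equivariant_change_locally cds cdz.
    exact: (tA _ Ac).1.
  exact: (tB _ Bd).1.
- move=> [tA _ AA] Ac Ad cdz.
  have [s cds] : exists s, equivariant_change r s c d.
    by apply: AA => //; exists z.
  apply: equivariant_change_locally cds cdz.
    exact: (tA _ Ac).1.
  exact: (tA _ Ad).1.
- move=> wB Bc Ad cdz; apply: locally_equivariant_sym; apply: IH => //.
    exact/(equivalence_weakly_regular AB).
  by rewrite overlapC.
- move=> wA Ac Cd [cz dz].
  have wB : weakly_regular_atlas r B by exact/(equivalence_weakly_regular AB).
  have [tB covB _] := wB.
  (* Only a neighborhood of [z] matters, so any chart of the middle atlas around [z] links [c] to
     [d]. *)
  have [e Be ez] := covB z.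
  apply: (@locally_equivariant_trans _ e); first exact: (tB _ Be).1.
    exact: IH.
  exact: IH'.
Qed.

Lemma local_action_weakly_regular r Q A :
  local_action r Q -> Q A -> weakly_regular_atlas r A.
Proof.
by move=> [A0 wr0 ->] /= A0A; exact/(equivalence_weakly_regular A0A).
Qed.

Lemma maximal_atlas_topological r Q c :
  local_action r Q -> maximal_atlas Q c -> topological_chart c.
Proof.
by move=> Qr [A QA Ac]; have [/(_ _ Ac)[]] := local_action_weakly_regular Qr QA.
Qed.

Lemma maximal_atlas_locally_equivariant r Q c d z : local_action r Q ->
  maximal_atlas Q c -> maximal_atlas Q d -> overlap c d z ->
  locally_equivariant c d z.
Proof.
move=> Qr [A QA Ac] [B QB Bd] cdz.
have wA := local_action_weakly_regular Qr QA.
have [A0 _ QE] := Qr; move: QA QB; rewrite QE /= => A0A A0B.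
apply: (equivalence_locally_equivariant _ wA Ac Bd cdz).
by apply: rst_trans A0B; exact: rst_sym.
Qed.

End local_equivariance.

(** * Representatives of the points of the orbit space *)

Section orbit_space_points.
Variables (R : realType) (n : nat) (M : topologicalType).
Local Notation chart := (chart R n M).
Implicit Types (F : set chart) (Q : set (set chart)).

(** The point of M represented by [e]; it is the only preimage in the chart domain once the chart is
    injective there. *)
Definition point_of F (e : chart_union F) : M :=
  projT1 (cid2 (set_valP (projT2 e))).

Lemma dom_point_of F (e : chart_union F) : dom (val (projT1 e)) (point_of e).
Proof. by rewrite /point_of; case: cid2. Qed.

Lemma chart_point_of F (e : chart_union F) :
  val (projT1 e) (point_of e) = val (projT2 e).
Proof. by rewrite /point_of; case: cid2. Qed.

Definition in_chart F (c : F) (z : M) (cz : dom (val c) z) : chart_union F :=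
  existT _ c (SigSub (mem_set (imageP (val c) cz))).

Lemma pi_orbit_spaceP Q (e e' : chart_union (maximal_atlas Q)) :
  \pi_(orbit_space Q) e = \pi_(orbit_space Q) e' <->
  clos_refl_sym_trans _ (@identified R n M (maximal_atlas Q)) e e'.
Proof.
split=> [/(eqmodP (orbit_equiv (maximal_atlas Q)))/asboolP//|ee'].
exact/(eqmodP (orbit_equiv (maximal_atlas Q)))/asboolP.
Qed.

End orbit_space_points.

(** * From a locally regular action to a trivialization of the cocycle *)

Section cocycle_of_action.
Variables (R : realType) (n : nat) (M : topologicalType).
Variables (r : smoothness) (Q : set (set (chart R n M))).
Variables (S : set (chart R n M)) (act : Qn R n -> M -> M).
Hypothesis Q_local : local_action r Q.
Hypothesis act_regular : locally_regular_action r S act.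
Hypothesis act_induces : induced_by r S act Q.
Implicit Types (a c : chart R n M) (s t : autQn R n).

(** All regular neighborhoods together form one regular atlas, which belongs to [Q] because the
    action induces [Q]. *)
Lemma regular_maximal c s :
  regular_neighborhood r S act c s -> maximal_atlas Q c.
Proof.
have [_ _ _ reg] := act_regular => cs.
pose T := [set cs : chart R n M * autQn R n |
  regular_neighborhood r S act cs.1 cs.2].
exists (fst @` T); last by exists (c, s).
apply: act_induces; split=> // z; have [d [t [dt dz]]] := reg z.
by exists d => //; exists (d, t).
Qed.

(** As [W] is invariant under the action, it contains the orbit of [z], and [s] depends on this
    orbit only. A chart of [Q] may carry different automorphisms along different orbits. *)
Definition acts_through a z s : Prop :=
  exists W, [/\ open W, W z, W `<=` dom a & forall q y, W y ->
    W (act q y) /\ a (act q y) = regular_rep (s q) (a y)].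

Lemma acts_through_exists a z : maximal_atlas Q a -> dom a z ->
  exists s, acts_through a z s.
Proof.
have [_ _ _ reg] := act_regular => Qa az.
have [c [t [ct cz]]] := reg z.
have [tc cinv _ _ cE] := ct.
have [s [W [oW Wz Wca sW]]] := maximal_atlas_locally_equivariant Q_local
  (regular_maximal ct) Qa (conj cz az).
exists (s * t)%g, W; split=> //; first by move=> y /Wca[].
move=> q y Wy; have [y' [Wy' cy' ay']] := sW (t q) y Wy.
(* The translate [y'] given by local equivariance is the one given by the action, since both have
   the same image in the regular chart [c]. *)
suff <- : y' = act q y by [].
apply: (topological_chart_inj tc); last by rewrite cE//; case: (Wca _ Wy).
- by have [] := Wca _ Wy'.
- by apply: cinv; have [] := Wca _ Wy.
Qed.

Lemma acts_through_dom a z s : acts_through a z s -> dom a z.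
Proof. by move=> [W [_ Wz Wa _]]; exact: Wa. Qed.

Lemma acts_through_act a z s p :
  acts_through a z s -> acts_through a (act p z) s.
Proof.
move=> [W [oW Wz Wa sW]]; exists W; split=> //.
by have [] := sW p z Wz.
Qed.

Lemma acts_through_change a c z rho t :
  topological_chart a -> topological_chart c ->
  equivariant_change r rho a c -> dom a z ->
  acts_through c z t -> acts_through a z (rho * t)%g.
Proof.
move=> [oa _ _ _] tc [_ cinv [g [gE _ geq]]] az [V [oV Vz Vc tV]].
exists (V `&` dom a); split; [exact: openI|by []|by move=> y []|].
move=> q y [Vy ay]; have acy : overlap a c y by split=> //; exact: Vc.
have [Vqy cqy] := tV q y Vy.
have cy : (c @` overlap a c) (c y) by exists y.
(* Invariance of the image of the overlap keeps [act q y] in [dom a]: it is the point [w], by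
   injectivity of [c]. *)
have [w [aw cw] wE] := cinv (t q) _ cy.
have wq : w = act q y.
  by apply: (topological_chart_inj tc) => //; [exact: Vc|rewrite wE cqy].
rewrite -wq; split; first by split=> //; rewrite wq.
by rewrite -gE// wE geq// gE.
Qed.

Lemma acts_through_unique a z s t : maximal_atlas Q a ->
  acts_through a z s -> acts_through a z t -> s = t.
Proof.
move=> Qa [W [oW Wz Wa sW]] [V [oV Vz Vc tV]].
have ta := maximal_atlas_topological Q_local Qa.
apply: autQn_ext => q.
apply: (@regular_rep_faithful _ _ (a @` (W `&` V))).
- apply: topological_chart_open => //; first exact: openI.
  by move=> y [/Wa].
- by exists (a z), z.
move=> _ [y [Wy Vy] <-].
by have [_ <-] := sW q y Wy; have [_ <-] := tV q y Vy.
Qed.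

Lemma identified_orbit (e e' : chart_union (maximal_atlas Q)) :
  identified e e' -> exists q, point_of e' = act q (point_of e).
Proof.
have [_ [act1 _] _ _] := act_regular.
move=> ee'.
have /= := dom_point_of e'; have /= := dom_point_of e.
have /= := chart_point_of e'; have /= := chart_point_of e.
(* The chosen preimages are abstracted, keeping only their defining equations, before the case
   analysis on dependent pairs. *)
move: (point_of e) (point_of e') => z w.
case: ee' => /= [c x y q yx|c d x y m [cm dm] xm ym] cz dw ez ew.
  have Qc := set_valP c.
  have tc := maximal_atlas_topological Q_local Qc.
  have [s cs] := acts_through_exists Qc ez.
  (* Multiplication by [q] in the chart is the action of [s^-1 q] on M. *)
  exists (aut_inv s q); apply: (topological_chart_inj tc) => //.
    exact: acts_through_dom (acts_through_act _ cs).
  have [W [_ Wz _ sW]] := cs.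
  by have [_ ->] := sW (aut_inv s q) z Wz; rewrite aut_invK dw cz.
exists 1%g; rewrite act1.
have -> : z = m.
  apply: (topological_chart_inj _ ez cm); last by rewrite cz.
  exact: maximal_atlas_topological Q_local (set_valP c).
apply: (topological_chart_inj _ ew dm); last by rewrite dw.
exact: maximal_atlas_topological Q_local (set_valP d).
Qed.

Lemma pi_orbit (e e' : chart_union (maximal_atlas Q)) :
  \pi_(orbit_space Q) e = \pi_(orbit_space Q) e' ->
  exists q, point_of e' = act q (point_of e).
Proof.
have [_ [act1 actM] _ _] := act_regular.
move/pi_orbit_spaceP; elim=> {e e'} [e e' /identified_orbit//|e|e e' _ [q ->]|].
- by exists 1%g; rewrite act1.
- by exists (q^-1)%g; rewrite -actM mulVg act1.
- by move=> e1 e2 e3 _ [q ->] _ [p ->]; exists (p * q)%g; rewrite actM.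
Qed.

Definition orbit_acts_through a : orbit_space Q -> set (autQn R n) :=
  fun b => [set s | exists2 e, b = \pi_(orbit_space Q) e &
    acts_through a (point_of e) s].

(** The 0-cochain s_a, as a function on B_M; it takes the default value 1 where no automorphism
    qualifies. *)
Definition acting_automorphism a (b : orbit_space Q) : autQn R n :=
  xget 1%g (orbit_acts_through a b).

Lemma acting_automorphismP a (e : chart_union (maximal_atlas Q)) s :
  maximal_atlas Q a -> acts_through a (point_of e) s ->
  acting_automorphism a (\pi_(orbit_space Q) e) = s.
Proof.
move=> Qa aes.
have : orbit_acts_through a (\pi_(orbit_space Q) e) s by exists e.
move=> /(xgetI 1%g)[e' /pi_orbit[q e'E]] ae'.
by apply: acts_through_unique Qa ae' _; rewrite e'E; exact: acts_through_act.
Qed.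

Lemma open_orbits (W : set M) : open W ->
  (forall q y, W y -> W (act q y)) ->
  open [set b : orbit_space Q | exists2 e, b = \pi_(orbit_space Q) e &
    W (point_of e)].
Proof.
move=> oW Winv.
(* Since equal classes lie in one orbit and [W] is invariant, the preimage of the set of orbits
   consists exactly of the representatives of points of [W]. Its openness is then checked chart by
   chart. *)
rewrite /open /= /quotient_open (_ : _ @^-1` _ =
    [set e : chart_union (maximal_atlas Q) | W (point_of e)]); last first.
  apply/seteqP; split=> [e /= [e' ee' We']|e /= We]; last by exists e.
  by have [q ->] := pi_orbit (esym ee'); exact: Winv.
apply/sigT_openP => c.
have tc := maximal_atlas_topological Q_local (set_valP c).
exists (val c @` (dom (val c) `&` W)).
  apply: topological_chart_open => //.
  by have [oc _ _ _] := tc; exact: openI.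
have cx x : dom (val c) (point_of (existT _ c x)) /\
    val c (point_of (existT _ c x)) = val x.
  by split; [exact: (@dom_point_of _ _ _ (maximal_atlas Q) (existT _ c x))|
    exact: (@chart_point_of _ _ _ (maximal_atlas Q) (existT _ c x))].
apply/seteqP; split=> x /=; have [cz czx] := cx x.
  move=> [z [cz' Wz] zx].
  rewrite (_ : point_of _ = z)//.
  by apply: (topological_chart_inj tc); rewrite ?czx.
by exists (point_of (existT _ c x)).
Qed.

(** The set [W] that witnesses [acts_through] at one point witnesses it with the same automorphism
    at all its points, and their orbits form an open set. *)
Lemma acting_automorphism_locally_constant a : maximal_atlas Q a ->
  locally_constant (orbit_chart Q a) (acting_automorphism a).
Proof.
move=> Qa b [e ea bE].
have ae : dom a (point_of e) by rewrite -ea; exact: dom_point_of.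
have [s aes] := acts_through_exists Qa ae.
have [W [oW We Wa sW]] := aes.
have oO := open_orbits oW (fun q y Wy => (sW q y Wy).1).
have Ob : nbhs b [set b : orbit_space Q | exists2 e, b = \pi_(orbit_space Q) e &
    W (point_of e)] by apply: open_nbhs_nbhs; split => //; exists e.
apply: filterS Ob => _ [e' -> We'] _.
rewrite bE (acting_automorphismP Qa aes); apply: acting_automorphismP => //.
by exists W.
Qed.

(** Two representatives of [b] differ by some [act q], so [a] and [c] are both defined at
    [point_of e']: charts whose orbit sets meet do overlap in M, and the automorphisms are compared
    there. *)
Lemma acting_automorphism_change a c rho b :
  maximal_atlas Q a -> maximal_atlas Q c ->
  (overlap a c !=set0 -> equivariant_change r rho a c) ->
  (orbit_chart Q a `&` orbit_chart Q c) b ->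
  rho = (acting_automorphism a b * (acting_automorphism c b)^-1)%g.
Proof.
move=> Qa Qc rhoP [[e ea ->] [e' ec ee']].
have [q e'E] := pi_orbit ee'.
have ae : dom a (point_of e) by rewrite -ea; exact: dom_point_of.
have ce' : dom c (point_of e') by rewrite -ec; exact: dom_point_of.
have [s aes] := acts_through_exists Qa ae.
have [t ce't] := acts_through_exists Qc ce'.
have ae' : dom a (point_of e').
  by rewrite e'E; exact: acts_through_dom (acts_through_act q aes).
have acrho : equivariant_change r rho a c by apply: rhoP; exists (point_of e').
have ta := maximal_atlas_topological Q_local Qa.
have tc := maximal_atlas_topological Q_local Qc.
have aes' := acts_through_change ta tc acrho ae' ce't.
by rewrite ee' (acting_automorphismP Qa aes') (acting_automorphismP Qc ce't)
  mulgK.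
Qed.

Lemma action_cech_trivial (A : set (chart R n M))
    (rho : A -> A -> autQn R n) : Q A ->
  transition_automorphisms r rho ->
  cech_cohomologous (fun a : A => orbit_chart Q (val a))
    (fun (a b : A) _ => rho a b) (@cech_trivial (orbit_space Q) (autQn R n) A).
Proof.
move=> QA rhoP.
have AQ (a : A) : maximal_atlas Q (val a) by exists A => //; exact: set_valP.
have rhoE (a b : A) x :
    (orbit_chart Q (val a) `&` orbit_chart Q (val b)) x ->
    rho a b = (acting_automorphism (val a) x
               * (acting_automorphism (val b) x)^-1)%g.
  by apply: acting_automorphism_change => //; exact: rhoP.
split.
- split=> [a b x _|a b c x [[ax bx] cx]]; first by apply: filterE.
  (* The cocycle identity is read off from the coboundary formula. *)
  by rewrite (rhoE a b x)// (rhoE b c x)// (rhoE a c x)// mulgA mulgVK.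
- by split=> [a b x _|a b c x _]; [apply: filterE|rewrite /cech_trivial mulg1].
exists (fun a : A => acting_automorphism (val a)).
  by move=> a; exact: acting_automorphism_locally_constant.
by move=> a b x abx; rewrite /cech_trivial mulg1; exact: rhoE.
Qed.

End cocycle_of_action.

(** * Pulling a trivializing cochain back from the orbit space to M *)

Section pointwise_trivialization.
Variables (R : realType) (n : nat) (M : topologicalType).
Variables (r : smoothness) (Q : set (set (chart R n M))).
Variables (A : set (chart R n M)) (rho : A -> A -> autQn R n).
Hypothesis Q_local : local_action r Q.
Hypothesis A_in_Q : Q A.

(** What remains of a trivializing 0-cochain on M: constancy along orbits, the coboundary formula,
    and local constancy in the form of open level sets. *)
Definition trivializes (t : A -> M -> autQn R n) : Prop :=
  [/\ forall a z w q, dom (val a) z -> dom (val a) w ->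
        val a w = regular_rep q (val a z) -> t a w = t a z,
      forall a b z, overlap (val a) (val b) z ->
        rho a b = (t a z * (t b z)^-1)%g &
      forall a s, open [set z | dom (val a) z /\ t a z = s]].

Lemma atlas_maximal (a : A) : val a \in maximal_atlas Q.
Proof. by rewrite inE; exists A => //; exact: set_valP. Qed.

Definition in_maximal (a : A) : maximal_atlas Q := SigSub (atlas_maximal a).

Definition orbit_of (a : A) z (az : dom (val a) z) : orbit_space Q :=
  \pi_(orbit_space Q) (@in_chart _ _ _ _ (in_maximal a) z az).

Lemma orbit_of_chart (a : A) z (az : dom (val a) z) :
  orbit_chart Q (val a) (orbit_of az).
Proof. by exists (@in_chart _ _ _ _ (in_maximal a) z az). Qed.

Lemma orbit_of_change (a b : A) z (az : dom (val a) z) (bz : dom (val b) z) :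
  orbit_of az = orbit_of bz.
Proof.
apply/pi_orbit_spaceP; apply: rst_step.
exact: (@Same_point _ _ _ _ (in_maximal a) (in_maximal b) _ _ z).
Qed.

Lemma orbit_of_orbit (a : A) z w q (az : dom (val a) z) (aw : dom (val a) w) :
  val a w = regular_rep q (val a z) -> orbit_of aw = orbit_of az.
Proof.
move=> wz; apply/esym/pi_orbit_spaceP; apply: rst_step.
exact: (@Same_orbit _ _ _ _ (in_maximal a) _ _ q).
Qed.

(** Continuity of the projection from [dom (val a)] to B_M, with an existential because [orbit_of]
    takes a proof of membership. *)
Lemma orbit_of_cvg (a : A) z (az : dom (val a) z) (U : set (orbit_space Q)) :
  nbhs (orbit_of az) U ->
  \forall w \near z, exists aw : dom (val a) w, U (orbit_of aw).
Proof.
move=> Uz.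
have ta := maximal_atlas_topological Q_local (set_valP (in_maximal a)).
have [oa _ _ _] := ta.
move: Uz; rewrite nbhsE => -[N [oN Nz] NU].
(* An open set of B_M pulls back to an open set of the disjoint union, whose trace on the image of
   [a] comes from an open [V] of H^n. *)
have [V oV VE] := (sigT_openP _).1 oN (in_maximal a).
have Vval w (aw : dom (val a) w) : V (val a w) <-> N (orbit_of aw).
  pose x := projT2 (@in_chart _ _ _ _ (in_maximal a) w aw).
  by have : (set_val @^-1` V) x <-> N (orbit_of aw) by rewrite VE.
have Vz : V (val a z) by apply/(Vval _ az).
have : nbhs z (dom (val a) `&` val a @^-1` V).
  apply: filterI; first exact: open_nbhs_nbhs.
  by apply: (topological_chart_cvg ta az); exact: open_nbhs_nbhs.
by apply: filterS => w [aw Vw]; exists aw; exact/NU/Vval.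
Qed.

Lemma cech_trivial_trivializes :
  cech_cohomologous (fun a : A => orbit_chart Q (val a))
    (fun a b _ => rho a b) (@cech_trivial (orbit_space Q) (autQn R n) A) ->
  exists t, trivializes t.
Proof.
move=> [_ _ [s s0 sE]].
(* The value 1 outside the domain of [a] is a mere default. *)
pose t (a : A) (z : M) : autQn R n :=
  if pselect (dom (val a) z) is left az then s a (orbit_of az) else 1%g.
have tE (a : A) z (az : dom (val a) z) : t a z = s a (orbit_of az).
  rewrite /t; case: pselect => // az'.
  by congr (s a (orbit_of _)); exact: Prop_irrelevance.
exists t; split.
- move=> a z w q az aw wz.
  by rewrite (tE _ _ az) (tE _ _ aw) (orbit_of_orbit az aw wz).
- move=> a b z [az bz]; rewrite (tE _ _ az) (tE _ _ bz).
  have abz : (orbit_chart Q (val a) `&` orbit_chart Q (val b)) (orbit_of az).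
    by split; [|rewrite (orbit_of_change az bz)]; exact: orbit_of_chart.
  by rewrite (sE _ _ _ abz) /cech_trivial mulg1 (orbit_of_change az bz).
- move=> a u; rewrite openE => z [az tz]; rewrite /interior.
  have /orbit_of_cvg := s0 a _ (orbit_of_chart az).
  apply: filterS => w [aw /(_ (orbit_of_chart aw)) sw]; split=> //.
  by rewrite (tE _ _ aw) sw -tE.
Qed.

End pointwise_trivialization.

(** * From a trivialization to a locally regular action *)

Lemma aut_fun1 (R : realType) n (s : autQn R n) : s 1%g = 1%g.
Proof. by apply: (@mulgI _ (s 1%g)); rewrite -aut_funM !mulg1. Qed.

Lemma Ck_fst (R : realType) (V W : normedModType R) k (A : set (V * W)) :
  Ck k A fst.
Proof.
by apply: (@Ck_linear _ _ _ k A (fst : {linear (V * W)%type -> V})) => x;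
  exact: cvg_fst.
Qed.

Lemma Ck_snd (R : realType) (V W : normedModType R) k (A : set (V * W)) :
  Ck k A snd.
Proof.
by apply: (@Ck_linear _ _ _ k A (snd : {linear (V * W)%type -> W})) => x;
  exact: cvg_snd.
Qed.

Section action_of_trivialization.
Variables (R : realType) (n : nat) (M : topologicalType).
Variables (r : smoothness) (A : set (chart R n M)) (rho : A -> A -> autQn R n).
Hypothesis A_regular : weakly_regular_atlas r A.
Hypothesis rhoP : transition_automorphisms r rho.
Variable t : A -> M -> autQn R n.
Hypothesis t_trivializes : trivializes rho t.
Implicit Types (a b : A) (s : autQn R n).

Let topA a : topological_chart (val a).
Proof. by have [/(_ _ (set_valP a))[]] := A_regular. Qed.

Let covA z : exists a, dom (val a) z.
Proof.
by have [_ /(_ z)[c Ac cz] _] := A_regular; exists (SigSub (mem_set Ac)).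
Qed.

(** The point [w] is found in one chart [b]. In another chart [a] the factor [t b z q] becomes
    [rho a b (t b z q)], which is [t a z q] by the coboundary formula. *)
Lemma twisted_action_exists q z : exists w, forall a, dom (val a) z ->
  dom (val a) w /\ val a w = regular_rep (t a z q) (val a z).
Proof.
have [_ t2 _] := t_trivializes.
have [b bz] := covA z.
have [/(_ _ (set_valP b))[_ binv] _ _] := A_regular.
have [w bw wE] : (val b @` dom (val b)) (regular_rep (t b z q) (val b z)).
  by apply: binv; exists z.
exists w => a az.
have abz : overlap (val a) (val b) z by [].
have [_ abinv [g [gE _ geq]]] := rhoP (ex_intro _ z abz).
(* Invariance of the image of the overlap places [w] in the domain of [a] too. *)
have [w' [aw' bw'] w'E] :
    (val b @` overlap (val a) (val b)) (regular_rep (t b z q) (val b z)).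
  by apply: abinv; exists z.
have ww' : w' = w.
  by apply: (topological_chart_inj (topA b)) => //; rewrite w'E wE.
rewrite -ww'; split=> //.
rewrite -gE// w'E geq; last by exists z.
rewrite gE// (t2 _ _ _ abz).
by rewrite -[X in regular_rep X _]/((t a z * (t b z)^-1 * t b z)%g q) mulgVK.
Qed.

Definition twisted_action q z : M := sval (cid (twisted_action_exists q z)).

Lemma twisted_action_dom a q z :
  dom (val a) z -> dom (val a) (twisted_action q z).
Proof. by rewrite /twisted_action; case: cid => /= w wP /wP[]. Qed.

Lemma twisted_actionE a q z : dom (val a) z ->
  val a (twisted_action q z) = regular_rep (t a z q) (val a z).
Proof. by rewrite /twisted_action; case: cid => /= w wP /wP[]. Qed.

(** This makes the action law hold: the second translation is twisted by the same automorphism as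
    the first. *)
Lemma twisted_action_t a q z : dom (val a) z -> t a (twisted_action q z) = t a z.
Proof.
have [t1 _ _] := t_trivializes => az.
apply: (t1 _ _ _ (t a z q)) => //; first exact: twisted_action_dom.
exact: twisted_actionE.
Qed.

Lemma twisted_action_is_action : is_action twisted_action.
Proof.
split=> [z|p q z]; have [a az] := covA z;
  apply: (topological_chart_inj (topA a));
  do ?[exact: az | apply: twisted_action_dom].
  by rewrite twisted_actionE// aut_fun1 regular_rep1.
rewrite !twisted_actionE//; last exact: twisted_action_dom.
by rewrite twisted_action_t// regular_repM aut_funM.
Qed.

Lemma weakly_regular_Cr_atlas : Cr_atlas r A.
Proof.
have [tA cov chg] := A_regular; split=> //; first by move=> c /tA[].
move=> c d Ac Ad.
have [cd|cd0] := pselect (overlap c d !=set0).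
  by have [s [_ _ [g [gE gd _]]]] := chg _ _ Ac Ad cd; exists g.
by apply: Cr_compatible_disjoint => //; [exact: (tA _ Ac).1|exact: (tA _ Ad).1].
Qed.

Lemma twisted_action_Cr : Cr_action r A twisted_action.
Proof.
have [_ _ t3] := t_trivializes.
move=> q x; have [a ax] := covA x.
have [N [F [oN Nq CF FE]]] := aut_fun_smooth (t a x) q.
(* Over this open set the twist is constant, and the action reads as [(p, y)] sent to [t a x p]
   times [y]; [F] extends the automorphism smoothly near [q]. *)
pose V := val a @` [set z | dom (val a) z /\ t a z = t a x].
have oV : open V.
  by apply: (topological_chart_open (topA a)); [exact: t3|move=> z []].
have oNV : open (N `*` V).
  rewrite openE => -[u v] [/= Nu Vv].
  by exists (N, V) => //; split; exact: open_nbhs_nbhs.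
exists (val a), (val a), (N `*` V), (fun p => hmul (F p.1) p.2); split.
- by split; exact: set_valP.
- exact: ax.
- by split=> //; split=> //; exists x.
- apply/CrE => k _; apply: Ck_hmul => //; last exact: Ck_snd.
  apply: (@Ck_comp _ _ _ _ _ _ _ N fst F) => //; [by move=> p []|exact: Ck_fst].
- move=> p y ay /= [Np [z [az tz] /(topological_chart_inj (topA a) az ay) zy]].
  split; first exact: twisted_action_dom.
  by rewrite twisted_actionE// FE// -zy tz.
Qed.

Definition level_chart a s : chart R n M :=
  chart_restr (val a) [set z | dom (val a) z /\ t a z = s].

Lemma level_chart_regular a s :
  regular_neighborhood r A twisted_action (level_chart a s) s.
Proof.
have [_ _ t3] := t_trivializes.
split=> /=.
- exact: topological_chart_restr.
- move=> q z [az [_ ts]]; have aqz := twisted_action_dom q az.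
  by split=> //; split=> //; rewrite twisted_action_t.
- move=> q _ [z [az [_ ts]] <-]; have aqz := twisted_action_dom (aut_inv s q) az.
  exists (twisted_action (aut_inv s q) z).
    by split=> //; split=> //; rewrite twisted_action_t.
  by rewrite twisted_actionE// ts aut_invK.
- move=> d Ad; apply: Cr_compatible_restr.
  by have [_ _] := weakly_regular_Cr_atlas; apply=> //; exact: set_valP.
- by move=> q z [az [_ ts]]; rewrite twisted_actionE// ts.
Qed.

Lemma twisted_action_locally_regular : locally_regular_action r A twisted_action.
Proof.
split.
- exact: weakly_regular_Cr_atlas.
- exact: twisted_action_is_action.
- exact: twisted_action_Cr.
- move=> z; have [a az] := covA z.
  exists (level_chart a (t a z)), (t a z); split=> //.
  exact: level_chart_regular.
Qed.

(** Every automorphism is allowed as a level; charts with empty domain are harmless. *)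
Definition level_atlas : set (chart R n M * autQn R n) :=
  [set cs | exists a, cs.1 = level_chart a cs.2].

Lemma level_atlas_regular : regular_atlas r A twisted_action level_atlas.
Proof.
split=> [_ s [a /= ->]|z]; first exact: level_chart_regular.
have [a az] := covA z.
exists (level_chart a (t a z)) => //.
by exists (level_chart a (t a z), t a z) => //; exists a.
Qed.

Lemma atlas_equivalent_level : equivalent_atlases r A (fst @` level_atlas).
Proof.
have [_ t2 _] := t_trivializes.
split=> //.
  exact: regular_atlas_weakly_regular weakly_regular_Cr_atlas level_atlas_regular.
move=> c _ Ac [[_ s] [b /= ->] <-] _.
(* Where [t b] equals [s], the chart [a] carries the action through [rho a b * s] and the level
   chart through [s]. *)
pose a : A := SigSub (mem_set Ac); exists (rho a b * s * s^-1)%g.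
apply: (@act_equivariant_change _ _ _ _ twisted_action (val a)).
- apply/Cr_compatible_sym/Cr_compatible_restr.
  by have [_ _] := weakly_regular_Cr_atlas; apply=> //; exact: set_valP.
- move=> q z [az [bz [_ ts]]]; split; first exact: twisted_action_dom.
  by split; [|split]; rewrite ?twisted_action_t//; exact: twisted_action_dom.
- move=> q z [az [bz [_ <-]]]; rewrite twisted_actionE//.
  by rewrite (t2 a b z)// mulgVK.
- by move=> q z [_ [bz [_ <-]]]; rewrite /= twisted_actionE.
Qed.

Lemma twisted_action_induces Q : local_action r Q -> Q A ->
  induced_by r A twisted_action Q.
Proof.
move=> [A0 _ ->] /= A0A T Treg.
(* The chain of equivalences runs from [A0] to [A], to the level atlas, and to [T]. *)
apply: rst_trans A0A _.
apply: rst_trans (rst_step _ _ _ _ atlas_equivalent_level) _.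
apply: rst_step; apply: regular_atlases_equivalent Treg.
  exact: weakly_regular_Cr_atlas.
exact: level_atlas_regular.
Qed.

End action_of_trivialization.

Theorem proposition2p12 (R : realType) (n : nat) (r : smoothness)
  (M : topologicalType) (M_hausdorff : hausdorff_space M)
  (M_compact : compact [set: M])
  (Q : set (set (chart R n M))) (Q_local : local_action r Q)
  (A : set (chart R n M)) (A_in_Q : Q A)
  (rho : A -> A -> autQn R n) (rhoP : transition_automorphisms r rho) :
  (exists (S : set (chart R n M)) (act : Qn R n -> M -> M),
    locally_regular_action r S act /\ induced_by r S act Q)
  <->
  cech_cohomologous (fun a : A => orbit_chart Q (val a))
    (fun a b _ => rho a b) (@cech_trivial (orbit_space Q) (autQn R n) A).
Proof.
split=> [[S [act [act_regular act_induces]]]|].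
  exact: (action_cech_trivial Q_local act_regular act_induces A_in_Q rhoP).
move=> /(cech_trivial_trivializes Q_local A_in_Q)[t tP].
have A_regular := local_action_weakly_regular Q_local A_in_Q.
(* The C^r structure on M is the one given by [A] itself. *)
exists A, (twisted_action A_regular rhoP tP); split.
  exact: twisted_action_locally_regular.
exact: twisted_action_induces.
Qed.
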